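(* Let $G$ be a graph on $n$ vertices and let $\{A,\overline{A}\}$ be a cut of $G$, i.e. a partition of $V(G)$ into $A$ and $\overline{A}=V(G)\setminus A$. Then $$\mathrm{VC}(A)\;\le\;\mathrm{cutbool}(A)\;\le\;\log_2 n\cdot \mathrm{VC}(A).$$
   Context: Graphs are finite, undirected and without loops. For $K\subseteq A$, $N(K)\cap\overline{A}$ denotes the set of vertices of $\overline{A}$ having at least one neighbor in $K$. Let $\mathcal{N}=\{N(K)\cap\overline{A} : K\subseteq A\}$. Define $\mathrm{cutbool}(A)=\log_2|\mathcal{N}|$. Define $\mathrm{VC}(A)$ to be the Vapnik-Chervonenkis dimension of the family $\mathcal{N}$ of subsets of $\overline{A}$, i.e. the maximum size of a set $T\subseteq\overline{A}$ that is shattered by $\mathcal{N}$, meaning that every subset $T'\subseteq T$ is of the form $T'=N(K)\cap T$ for some $K\subseteq A$. *)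

(* Defs.v *)
From mathcomp Require Import all_boot all_order all_algebra.
From mathcomp Require Import reals exp.

Set Implicit Arguments.
Unset Strict Implicit.
Unset Printing Implicit Defensive.

(* A simple graph on a finite vertex type
   V is given by its adjacency relation, assumed symmetric and irreflexive where
   it is used. *)

Import GRing.Theory Num.Theory.

Section Cut.
Variables (V : finType) (adj : rel V).

Definition nbhd (K : {set V}) : {set V} := [set v | [exists u in K, adj u v]].

Definition cut_nbhds (A : {set V}) : {set {set V}} :=
  [set nbhd K :&: ~: A | K : {set V} in powerset A].

End Cut.

Section VapnikChervonenkis.
Variable V : finType.

Definition shatters (F : {set {set V}}) (S : {set V}) : bool :=
  [forall S' : {set V}, (S' \subset S) ==> [exists X in F, S' == X :&: S]].

(* For F empty this maximum is over no set, hence 0; cut_nbhds is never empty. *)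
Definition vc_dim (U : {set V}) (F : {set {set V}}) : nat :=
  \max_(S : {set V} | (S \subset U) && shatters F S) #|S|.

End VapnikChervonenkis.

Definition VC (V : finType) (adj : rel V) (A : {set V}) : nat :=
  vc_dim (~: A) (cut_nbhds adj A).

Local Open Scope ring_scope.

(* log2 0 = 0, since ln 0 = 0. *)
Definition log2 (R : realType) (x : R) : R := ln x / ln 2.

Definition cutbool (R : realType) (V : finType) (adj : rel V) (A : {set V}) : R :=
  log2 #|cut_nbhds adj A|%:R.

(* Main.v *)
Require Import Defs.
From mathcomp Require Import all_boot all_order all_algebra.
From mathcomp Require Import reals exp.

(** Taking logarithms, the two inequalities are [2 ^ VC <= #|N| <= n ^ VC], where
    [N] is the family of traces [N(K) :&: ~: A] for [K] a subset of [A].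

    The left one holds for every nonempty family: if [S] is shattered, then
    [X |-> X :&: S] maps the family onto the [2 ^ #|S|] subsets of [S]
    ([expn_vc_dim]).

    The right one uses that [N] consists of unions of the neighbourhoods of
    single vertices. Write a trace as [N(K)] with [K] minimal. By minimality
    every [u] in [K] has a private neighbour outside [A], adjacent to no other
    vertex of [K] ([minimal_private]). Choosing one private neighbour for each
    [u] gives a set of size [#|K|] shattered by the traces of the subsets of [K]
    ([private_leq_VC]), so [#|K| <= VC]. Hence every trace comes from some [K]
    with at most [VC] elements ([small_generator]). Such a [K] is listed by a
    function from ['I_VC] to the [n] vertices, the spare indices being sent
    outside [A], so there are at most [n ^ VC] traces ([card_cut_nbhds]). *)

Import Order.TTheory GRing.Theory Num.Theory.

Lemma shattersP {V : finType} {F : {set {set V}}} {S : {set V}} :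
  reflect (forall S' : {set V}, S' \subset S ->
             exists2 X, X \in F & S' = X :&: S)
          (shatters F S).
Proof.
apply: (iffP forallP) => [sh S' sS'|sh S'].
  by have /existsP[X /andP[XF /eqP ->]] := implyP (sh S') sS'; exists X.
apply/implyP => /sh[X XF ->]; apply/existsP; exists X.
by rewrite XF eqxx.
Qed.

Lemma shatters_card (V : finType) (F : {set {set V}}) (S : {set V}) :
  shatters F S -> 2 ^ #|S| <= #|F|.
Proof.
move=> /shattersP sh; rewrite -card_powerset.
apply: leq_trans (leq_imset_card (fun X => X :&: S) F).
apply/subset_leq_card/subsetP => S'; rewrite powersetE => /sh[X XF ->].
exact: imset_f.
Qed.

(** Nonemptiness of the family serves the case where the maximum defining
    [vc_dim] is over no set: [vc_dim] is then [0], and [1 <= #|F|] is needed. *)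
Lemma expn_vc_dim (V : finType) (U : {set V}) (F : {set {set V}}) :
  0 < #|F| -> 2 ^ vc_dim U F <= #|F|.
Proof.
move=> F0; apply: (big_ind (fun d => 2 ^ d <= #|F|)) => //.
  by move=> a b ha hb; rewrite /maxn; case: ifP.
by move=> S /andP[_ /shatters_card].
Qed.

Lemma nbhdP {V : finType} {adj : rel V} {K : {set V}} {v : V} :
  reflect (exists2 u, u \in K & adj u v) (v \in nbhd adj K).
Proof. by rewrite inE; apply: exists_inP. Qed.

Lemma nbhdS (V : finType) (adj : rel V) (K K' : {set V}) :
  K \subset K' -> nbhd adj K \subset nbhd adj K'.
Proof.
move=> /subsetP sK; apply/subsetP => v /nbhdP[u uK uv].
by apply/nbhdP; exists u; first exact: sK.
Qed.

Lemma mem_cut_nbhds (V : finType) (adj : rel V) (A K : {set V}) :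
  K \subset A -> nbhd adj K :&: ~: A \in cut_nbhds adj A.
Proof. by move=> sKA; apply: imset_f; rewrite powersetE. Qed.

Lemma cut_nbhds_gt0 (V : finType) (adj : rel V) (A : {set V}) :
  0 < #|cut_nbhds adj A|.
Proof.
by apply/card_gt0P; exists (nbhd adj set0 :&: ~: A); apply/mem_cut_nbhds/sub0set.
Qed.

(** The map [p] chooses private neighbours. It is injective on [K], and for [S']
    inside [p @: K] the vertices of [K] whose private neighbour lies in [S']
    see exactly [S'] within [p @: K], so [p @: K] is shattered. *)
Lemma private_leq_VC (V : finType) (adj : rel V) (A K : {set V}) (p : V -> V) :
  K \subset A -> {in K, forall u, p u \notin A} ->
  {in K &, forall w u, adj w (p u) = (w == u)} -> #|K| <= VC adj A.
Proof.
move=> sKA pA pK.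
have p_inj : {in K &, injective p}.
  by move=> w u wK uK e; apply/eqP; rewrite -pK // -e pK.
rewrite -(card_in_imset p_inj) /VC /vc_dim.
apply: (leq_bigmax_cond (F := fun S : {set V} => #|S|)).
apply/andP; split; first by apply/subsetP => _ /imsetP[u uK ->]; rewrite inE pA.
apply/shattersP => S' /subsetP sS'.
pose K' := [set u in K | p u \in S'].
have sK' : K' \subset K by apply/subsetP => u; rewrite inE => /andP[].
exists (nbhd adj K' :&: ~: A).
  exact/mem_cut_nbhds/(subset_trans sK').
apply/setP => v; rewrite 2!in_setI in_setC; apply/idP/idP => [vS'|].
  have vS := sS' _ vS'; rewrite vS andbT.
  case/imsetP: vS vS' => u uK -> uS'; rewrite pA // andbT.
  by apply/nbhdP; exists u; [rewrite inE uK | rewrite pK].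
case/andP => /andP[/nbhdP[w wK' wv] _] /imsetP[u uK vE].
move: wK' wv; rewrite inE vE => /andP[wK wS'].
by rewrite pK // => /eqP <-.
Qed.

(** Were there no such neighbour of [u], removing [u] from [K] would leave the
    trace unchanged, against minimality. *)
Lemma minimal_private (V : finType) (adj : rel V) (A K : {set V}) (u : V) :
  minset (fun K' => nbhd adj K' :&: ~: A == nbhd adj K :&: ~: A) K -> u \in K ->
  exists2 v, v \notin A & {in K, forall w, adj w v = (w == u)}.
Proof.
move=> /minsetP[_ minK] uK.
have : ~~ (nbhd adj K :&: ~: A \subset nbhd adj (K :\ u) :&: ~: A).
  apply/negP => sub; suff eK : K :\ u = K by move: uK; rewrite -eK setD11.
  apply: minK; last exact: subD1set.
  by rewrite eqEsubset sub andbT setSI // nbhdS // subD1set.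
case/subsetPn => v /setIP[/nbhdP[w wK wv] vA] vN; exists v.
  by rewrite -in_setC.
have only_u x : x \in K -> adj x v -> x = u.
  move=> xK xv; apply/eqP; apply: contraNT vN => xu.
  by rewrite in_setI vA andbT; apply/nbhdP; exists x => //; rewrite in_setD1 xu.
have wu := only_u w wK wv.
move=> x xK; apply/idP/eqP => [|->]; first exact: only_u.
by rewrite -wu.
Qed.

(** A minimal generating set of a trace has one private neighbour per element,
    hence at most [VC] elements. *)
Lemma small_generator (V : finType) (adj : rel V) (A X : {set V}) :
  X \in cut_nbhds adj A ->
  exists K : {set V},
    [/\ K \subset A, #|K| <= VC adj A & nbhd adj K :&: ~: A = X].
Proof.
case/imsetP => K0; rewrite powersetE => sK0A XE.
have [|K minK sKK0] :=
  @minset_exists _ (fun K' => nbhd adj K' :&: ~: A == X) K0.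
  by rewrite XE.
have sKA := subset_trans sKK0 sK0A.
have KX : nbhd adj K :&: ~: A = X by apply/eqP/(minsetp minK).
exists K; split => //; rewrite -{}KX in minK.
pose private u v := (v \notin A) && [forall w in K, adj w v == (w == u)].
pose p u := odflt u [pick v | private u v].
have pP u : u \in K -> private u (p u).
  move=> uK; rewrite /p; case: pickP => //= no_private.
  have [v vA vK] := @minimal_private _ _ _ _ u minK uK.
  have := no_private v; rewrite /private vA /=.
  by move/forall_inP; case=> w wK; rewrite vK.
apply: (@private_leq_VC _ _ _ _ p) => // [u /pP /andP[] //|w u wK /pP /andP[_]].
by move=> /forall_inP /(_ w wK) /eqP.
Qed.

Lemma card_cut_nbhds (V : finType) (adj : rel V) (A : {set V}) :
  #|cut_nbhds adj A| <= #|V| ^ VC adj A.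
Proof.
have [A'0|[v0 v0A]] := set_0Vmem (~: A).
  (* With no vertex to pad with, the only trace is empty and VC is 0. *)
  have -> : VC adj A = 0.
    apply/eqP; rewrite -leqn0; apply/bigmax_leqP => S /andP[].
    by rewrite A'0 subset0 => /eqP ->; rewrite cards0.
  rewrite expn0 -(cards1 (set0 : {set V})); apply/subset_leq_card/subsetP => X.
  by case/imsetP => K _ ->; rewrite A'0 setI0 inE.
set d := VC adj A.
pose g (f : {ffun 'I_d -> V}) := nbhd adj (A :&: [set f i | i in 'I_d]) :&: ~: A.
rewrite -[d in _ ^ d]card_ord -card_ffun -cardsT.
apply: leq_trans (leq_imset_card g _).
apply/subset_leq_card/subsetP => X /small_generator[K [sKA Kd <-]].
apply/imsetP; exists [ffun i : 'I_d => nth v0 (enum K) i] => //.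
congr (nbhd adj _ :&: _); apply/setP => u; rewrite in_setI.
apply/idP/andP => [uK|[uA /imsetP[i _]]].
  split; first exact: (subsetP sKA).
  have uE : u \in enum K by rewrite mem_enum.
  have ud : index u (enum K) < d.
    by apply: leq_trans Kd; rewrite cardE index_mem.
  by apply/imsetP; exists (Ordinal ud); rewrite // ffunE /= nth_index.
rewrite ffunE => uE; have [iK|Ki] := ltnP i (size (enum K)).
  by rewrite uE -mem_enum mem_nth.
by move: v0A; rewrite inE -(nth_default v0 Ki) -uE uA.
Qed.

Local Open Scope ring_scope.

Lemma ler_log2_nat (R : realType) (a b : nat) :
  (0 < a)%N -> (a <= b)%N -> log2 (a%:R : R) <= log2 (b%:R : R).
Proof.
move=> a0 ab; rewrite /log2 ler_wpM2r ?invr_ge0 ?ln_ge0 ?ler1n //.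
by rewrite ler_ln ?posrE ?ltr0n ?ler_nat // (leq_trans a0).
Qed.

(** For [a = 0] and [d > 0] both sides vanish through the convention [log2 0 = 0]. *)
Lemma log2_expn (R : realType) (a d : nat) :
  log2 ((a ^ d)%:R : R) = log2 (a%:R : R) * d%:R.
Proof.
rewrite /log2 mulrAC; congr (_ / _).
have [->|a0] := posnP a; last by rewrite natrX lnXn ?ltr0n // mulr_natr.
case: d => [|d]; first by rewrite expn0 ln1 mulr0.
by rewrite exp0n // ln0 // mul0r.
Qed.

Lemma log2_2 (R : realType) : log2 (2%:R : R) = 1.
Proof. by rewrite /log2 divff // gt_eqF // ln_gt0 // ltr1n. Qed.

Theorem theorem4 (R : realType) (n : nat) (V : finType) (adj : rel V)
    (adj_sym : symmetric adj) (adj_irr : irreflexive adj)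
    (card_V : #|V| = n) (A : {set V}) :
  ((VC adj A)%:R <= cutbool R adj A) /\
  (cutbool R adj A <= log2 (n%:R : R) * (VC adj A)%:R).
Proof.
rewrite -card_V -log2_expn /cutbool; have N0 := cut_nbhds_gt0 _ adj A; split.
  have <- : log2 ((2 ^ VC adj A)%:R : R) = (VC adj A)%:R.
    by rewrite log2_expn log2_2 mul1r.
  by rewrite ler_log2_nat ?expn_gt0 // expn_vc_dim.
by rewrite ler_log2_nat ?card_cut_nbhds.
Qed.
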